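(* Let $V=\{v_1,\dots,v_n\}$ be partitioned into $k$ ground truth clusters $\mathcal C_1,\dots,\mathcal C_k$, all of the same size $|\mathcal C|$. In the signed stochastic block model, let $p_{\mathrm{in}}^+$ (resp. $p_{\mathrm{in}}^-$) be the probability of a positive (resp. negative) edge between nodes in the same cluster, and $p_{\mathrm{out}}^+$ (resp. $p_{\mathrm{out}}^-$) the probability of a positive (resp. negative) edge between nodes in different clusters. Let $\mathcal L_{GM}=\mathcal L_{\mathrm{sym}}^+\#\mathcal Q_{\mathrm{sym}}^-$ be the geometric mean of the normalized Laplacian $\mathcal L_{\mathrm{sym}}^+$ of the expected positive graph and the normalized signless Laplacian $\mathcal Q_{\mathrm{sym}}^-$ of the expected negative graph. Let $\boldsymbol\chi_1=\mathbf 1$ and $\boldsymbol\chi_i=(k-1)\mathbf 1_{\mathcal C_i}-\mathbf 1_{\overline{\mathcal C_i}}$ for $i=2,\dots,k$. Then $\boldsymbol\chi_1,\dots,\boldsymbol\chi_k$ are the eigenvectors corresponding to the $k$ smallest eigenvalues of $\mathcal L_{GM}$ if and only if the following condition holds: $$\left(\frac{k\,p_{\mathrm{out}}^+}{p_{\mathrm{in}}^++(k-1)p_{\mathrm{out}}^+}\right)\left(1+\frac{p_{\mathrm{in}}^--p_{\mathrm{out}}^-}{p_{\mathrm{in}}^-+(k-1)p_{\mathrm{out}}^-}\right)<1.$$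
   Context: Expected graphs: $\mathcal W^+$ and $\mathcal W^-$ are the $n\times n$ expected weight matrices, with $\mathcal W^{+}_{ij}=p_{\mathrm{in}}^{+}$ and $\mathcal W^{-}_{ij}=p_{\mathrm{in}}^{-}$ if $v_i,v_j$ belong to the same cluster, and $\mathcal W^{+}_{ij}=p_{\mathrm{out}}^{+}$ and $\mathcal W^{-}_{ij}=p_{\mathrm{out}}^{-}$ if $v_i,v_j$ belong to different clusters. $\mathcal D^{\pm}$ is the diagonal degree matrix with $\mathcal D^{\pm}_{ii}=\sum_j\mathcal W^{\pm}_{ij}$. The normalized Laplacian of the expected positive graph is $\mathcal L_{\mathrm{sym}}^+=(\mathcal D^+)^{-1/2}(\mathcal D^+-\mathcal W^+)(\mathcal D^+)^{-1/2}$, and the normalized signless Laplacian of the expected negative graph is $\mathcal Q_{\mathrm{sym}}^-=(\mathcal D^-)^{-1/2}(\mathcal D^-+\mathcal W^-)(\mathcal D^-)^{-1/2}$. Geometric mean: for positive definite $A,B$, $A\#B=A^{1/2}(A^{-1/2}BA^{-1/2})^{1/2}A^{1/2}$, where $X^{1/2}$ is the unique positive definite square root of $X$. Since the Laplacian and the signless Laplacian are in general only positive semidefinite, the standing convention is that the two matrices entering the geometric mean are modified by a small diagonal shift ensuring positive definiteness (that is, in practice $\mathcal L_{\mathrm{sym}}^++\varepsilon_1I$ and $\mathcal Q_{\mathrm{sym}}^-+\varepsilon_2I$, with $\varepsilon_1,\varepsilon_2$ small positive numbers), and that these shifts are not written explicitly. Notation: $\mathbf 1\in\mathbb R^n$ is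 the all-ones vector, $\mathbf 1_S$ is the indicator vector of $S\subseteq V$, and $\overline S=V\setminus S$. ''Eigenvectors corresponding to the $k$ smallest eigenvalues'' is meant in the sense that the eigenvalues of $\boldsymbol\chi_1,\dots,\boldsymbol\chi_k$ are strictly smaller than the eigenvalue corresponding to the remaining eigenvectors. *)

(* Defs.v *)
From mathcomp Require Import all_boot all_order all_algebra.
From mathcomp Require Import reals.
From mathcomp Require classical_sets.

Set Implicit Arguments.
Unset Strict Implicit.
Unset Printing Implicit Defensive.

Import Order.TTheory GRing.Theory Num.Theory.
Local Open Scope ring_scope.

Definition posdefmx (R : realType) (n : nat) (A : 'M[R]_n) : Prop :=
  A^T = A /\ forall x : 'rV[R]_n, x != 0 -> 0 < (x *m A *m x^T) 0 0.

(* [A^{1/2}] for [A] positive definite, its unique positive definite square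
   root; the value is [0] when there is no positive definite square root. *)
Definition sqrtmx (R : realType) (n : nat) (A : 'M[R]_n) : 'M[R]_n :=
  classical_sets.xget 0 (fun X : 'M[R]_n => posdefmx X /\ X *m X = A).

(* [A^{-1/2}] *)
Definition invsqrtmx (R : realType) (n : nat) (A : 'M[R]_n) : 'M[R]_n :=
  invmx (sqrtmx A).

Definition geomeanmx (R : realType) (n : nat) (A B : 'M[R]_n) : 'M[R]_n :=
  sqrtmx A *m sqrtmx (invsqrtmx A *m B *m invsqrtmx A) *m sqrtmx A.

Definition degmx (R : realType) (n : nat) (W : 'M[R]_n) : 'M[R]_n :=
  diag_mx (\row_i \sum_j W i j).

Definition norm_laplacian (R : realType) (n : nat) (W : 'M[R]_n) : 'M[R]_n :=
  invsqrtmx (degmx W) *m (degmx W - W) *m invsqrtmx (degmx W).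

Definition norm_signless_laplacian (R : realType) (n : nat) (W : 'M[R]_n) :
    'M[R]_n :=
  invsqrtmx (degmx W) *m (degmx W + W) *m invsqrtmx (degmx W).

(* The vertex set is partitioned into [k] labelled clusters of size [c]. *)
Definition equal_clusters (n k c : nat) (C : 'I_k -> {set 'I_n}) : Prop :=
  [/\ injective C,
      partition [set C i | i : 'I_k] [set: 'I_n]
    & forall i, #|C i| = c].

Definition same_cluster (n k : nat) (C : 'I_k -> {set 'I_n}) : rel 'I_n :=
  fun v w => [exists i, (v \in C i) && (w \in C i)].

(* Diagonal entries are [p_in] too: a node is in the same cluster as itself. *)
Definition expected_weight (R : realType) (n k : nat) (C : 'I_k -> {set 'I_n})
    (p_in p_out : R) : 'M[R]_n :=
  \matrix_(v, w) if same_cluster C v w then p_in else p_out.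

(* The shifts [eps1], [eps2] make both arguments of the mean positive definite;
   superscripts + and - are written [pos] and [neg]. *)
Definition expected_LGM (R : realType) (n k : nat) (C : 'I_k -> {set 'I_n})
    (p_in_pos p_out_pos p_in_neg p_out_neg eps1 eps2 : R) : 'M[R]_n :=
  geomeanmx
    (norm_laplacian (expected_weight C p_in_pos p_out_pos) + eps1%:M)
    (norm_signless_laplacian (expected_weight C p_in_neg p_out_neg) + eps2%:M).

(* The vectors [chi_1, ..., chi_k] are the rows; [chi_1], the all-ones vector,
   is the row of index [0], and the row of index [i > 0] is
   [(k - 1) 1_{C i} - 1_{~ C i}]. *)
Definition chi (R : realType) (n k : nat) (C : 'I_k -> {set 'I_n}) :
    'M[R]_(k, n) :=
  \matrix_(i, v)
    if i == 0%N :> nat then 1 else if v \in C i then k%:R - 1 else -1.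

(* The rows of [X] are linearly independent eigenvectors of [A], and their
   eigenvalues are strictly smaller than that of any eigenvector of [A] outside
   their span.  Eigenvectors are row vectors ([u *m A = mu *: u]), which for a
   symmetric [A] agree with column eigenvectors. *)
Definition smallest_eigenvectors (R : realType) (n k : nat)
    (A : 'M[R]_n) (X : 'M[R]_(k, n)) : Prop :=
  row_free X /\
  exists lambda : 'I_k -> R,
    (forall i, (row i X <= eigenspace A (lambda i))%MS) /\
    (forall (mu : R) (u : 'rV[R]_n),
       (u <= eigenspace A mu)%MS -> ~~ (u <= X)%MS ->
       forall i, lambda i < mu).

(* Main.v *)
(* Every matrix in sight is a combination of the three orthogonal projections
   on the constant vectors, on the cluster-wise constant vectors of zero sum, and
   on the vectors of zero sum on each cluster.  On these spaces the Laplacian has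
   the eigenvalues [0, a, 1] and the signless Laplacian [2, b, 1], where [a] and
   [b] are the two factors of the condition; since the matrices commute, the
   geometric mean has the eigenvalues [sqrt (e1 * (2 + e2))],
   [sqrt ((a + e1) * (b + e2))] and [sqrt ((1 + e1) * (1 + e2))].  The vectors
   [chi] span the first two spaces, so they are the smallest eigenvectors iff the
   third eigenvalue exceeds the other two, which for all small [e1, e2 > 0]
   amounts to [a * b < 1]. *)

Require Import Defs.
From mathcomp Require Import all_boot all_order all_algebra.
From mathcomp Require Import reals.
From mathcomp Require Import ring lra.
From mathcomp Require classical_sets.

Import Order.TTheory GRing.Theory Num.Theory.
Local Open Scope ring_scope.

Set Implicit Arguments.
Unset Strict Implicit.

(** * Positive definite matrices and the uniqueness of their square roots *)

Section PositiveDefinite.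

Variables (R : realType) (n : nat).
Implicit Types A X Y Z : 'M[R]_n.

Lemma dot_ge0 (y : 'rV[R]_n) : 0 <= (y *m y^T) 0 0.
Proof. by rewrite mxE sumr_ge0 // => j _; rewrite mxE -expr2 sqr_ge0. Qed.

Lemma dot_eq0 (y : 'rV[R]_n) : (y *m y^T) 0 0 = 0 -> y = 0.
Proof.
rewrite mxE => /psumr_eq0P y0; apply/rowP=> j; rewrite mxE.
apply/eqP; rewrite -sqrf_eq0 expr2.
have := y0 _ j isT; rewrite mxE => -> // i _.
by rewrite mxE -expr2 sqr_ge0.
Qed.

Lemma mxtrace_congr X Z :
  \tr (Z *m X *m Z^T) = \sum_i (row i Z *m X *m (row i Z)^T) 0 0.
Proof.
apply: eq_bigr => i _; rewrite !mxE; apply: eq_bigr => j _.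
by rewrite -row_mul !mxE.
Qed.

Lemma posdefmx_congr_ge0 X (x : 'rV[R]_n) :
  posdefmx X -> 0 <= (x *m X *m x^T) 0 0.
Proof.
case=> _ Xpos; have [->|/Xpos/ltW//] := eqVneq x 0.
by rewrite !mul0mx mxE.
Qed.

Lemma mxtrace_congr_ge0 X Z : posdefmx X -> 0 <= \tr (Z *m X *m Z^T).
Proof.
by move=> Xpos; rewrite mxtrace_congr sumr_ge0 // => i _; apply: posdefmx_congr_ge0.
Qed.

(** The trace is the sum of the values of the quadratic form of [X] at the rows of [Z]; these are
    nonnegative, hence all zero, and definiteness kills each row. *)
Lemma mxtrace_congr_eq0 X Z :
  posdefmx X -> \tr (Z *m X *m Z^T) = 0 -> Z = 0.
Proof.
move=> Xpos; rewrite mxtrace_congr => /psumr_eq0P Z0.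
apply/row_matrixP=> i; rewrite row0; apply/eqP/negPn/negP => /(proj2 Xpos).
by rewrite Z0 ?ltxx // => j _; apply: posdefmx_congr_ge0.
Qed.

(* For [Z = X - Y], [X *m Z + Z *m Y = 0]; multiplying by [Z] and taking traces
   gives two nonnegative terms of sum zero. *)
Lemma posdefmx_sqr_inj X Y :
  posdefmx X -> posdefmx Y -> X *m X = Y *m Y -> X = Y.
Proof.
move=> Xpos Ypos eqXY; apply/eqP; rewrite -subr_eq0; apply/eqP.
set Z := X - Y.
have ZT : Z^T = Z by rewrite /Z linearB /= (proj1 Xpos) (proj1 Ypos).
have XZ : X *m Z + Z *m Y = 0.
  by rewrite /Z mulmxBr mulmxBl eqXY addrA subrK subrr.
have trZ : \tr (Z *m X *m Z^T) + \tr (Z *m Y *m Z^T) = 0.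
  (* Cyclicity moves the last [Z] of the second term to the front, so that the two traces combine
     into that of [Z *m (X *m Z + Z *m Y)]. *)
  rewrite ZT -[\tr (Z *m Y *m Z)]mxtrace_mulC -mxtraceD -!mulmxA -mulmxDr.
  by rewrite XZ mulmx0 mxtrace0.
apply: (@mxtrace_congr_eq0 X) => //; apply/eqP.
by have /eqP := trZ; rewrite paddr_eq0 ?mxtrace_congr_ge0 // => /andP[].
Qed.

(** Since [sqrtmx] is an arbitrary choice among the positive definite roots, uniqueness of the root
    is what allows it to be computed by exhibiting one. *)
Lemma sqrtmx_unique A X : posdefmx X -> X *m X = A -> sqrtmx A = X.
Proof.
move=> Xpos XA; apply: classical_sets.xget_subset1 => //.
by move=> Y1 Y2 [? <-] [? ?]; apply: posdefmx_sqr_inj.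
Qed.

Lemma invmx_unique X Y : X *m Y = 1%:M -> invmx X = Y.
Proof.
move=> XY; have [Xu _] := mulmx1_unit XY.
by rewrite -[LHS]mulmx1 -XY mulKmx.
Qed.

End PositiveDefinite.

(** * Functional calculus on a resolution of the identity into orthogonal projections *)

Section SpectralResolution.

Variables (R : realType) (n : nat) (I : finType) (P : I -> 'M[R]_n).
Hypothesis P_mul : forall i j, P i *m P j = if i == j then P i else 0.
Hypothesis P_sum : \sum_i P i = 1%:M.
Hypothesis P_sym : forall i, (P i)^T = P i.

Definition spectral (a : I -> R) : 'M[R]_n := \sum_i a i *: P i.

Lemma eq_spectral a b : a =1 b -> spectral a = spectral b.
Proof. by move=> ab; apply: eq_bigr => i _; rewrite ab. Qed.

Lemma spectral_const (x : R) : spectral (fun=> x) = x%:M.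
Proof. by rewrite /spectral -scaler_sumr P_sum scalemx1. Qed.

Lemma spectralD a b : spectral a + spectral b = spectral (fun i => a i + b i).
Proof. by rewrite -big_split /=; apply: eq_bigr => i _; rewrite scalerDl. Qed.

Lemma spectralB a b : spectral a - spectral b = spectral (fun i => a i - b i).
Proof.
rewrite /spectral -sumrB.
by apply: eq_bigr => i _; rewrite scalerBl.
Qed.

Lemma mul_proj_spectral j a : P j *m spectral a = a j *: P j.
Proof.
rewrite mulmx_sumr (bigD1 j) //= -scalemxAr P_mul eqxx big1 ?addr0 // => i ij.
by rewrite -scalemxAr P_mul eq_sym (negPf ij) scaler0.
Qed.

Lemma mul_spectral_proj j a : spectral a *m P j = a j *: P j.
Proof.
rewrite mulmx_suml (bigD1 j) //= -scalemxAl P_mul eqxx big1 ?addr0 // => i ij.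
by rewrite -scalemxAl P_mul (negPf ij) scaler0.
Qed.

Lemma spectralM a b : spectral a *m spectral b = spectral (fun i => a i * b i).
Proof.
rewrite {1}/spectral mulmx_suml; apply: eq_bigr => i _.
by rewrite -scalemxAl mul_proj_spectral scalerA.
Qed.

Lemma spectral_sym a : (spectral a)^T = spectral a.
Proof.
by rewrite /spectral linear_sum; apply: eq_bigr => i _; rewrite linearZ /= P_sym.
Qed.

(** The quadratic form is the sum of the squared norms of the components [x *m P i] weighted by
    [a i]. If it vanishes, so do all components, and they add up to [x]. *)
Lemma spectral_posdef a : (forall i, 0 < a i) -> posdefmx (spectral a).
Proof.
move=> a_gt0; split=> [|x x0]; first exact: spectral_sym.
pose y i := x *m P i.
have -> : x *m spectral a *m x^T = \sum_i a i *: (y i *m (y i)^T).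
  rewrite /spectral mulmx_sumr mulmx_suml; apply: eq_bigr => i _.
  rewrite -scalemxAr -scalemxAl; congr (_ *: _).
  by rewrite /y trmx_mul P_sym mulmxA -(mulmxA x) P_mul eqxx.
rewrite summxE lt_def.
have s_ge0 i : 0 <= (a i *: (y i *m (y i)^T)) 0 0.
  by rewrite mxE mulr_ge0 ?dot_ge0 // ltW.
rewrite sumr_ge0 // andbT; apply: contra x0 => /eqP/psumr_eq0P y0.
rewrite -[x]mulmx1 -P_sum mulmx_sumr big1 // => i _.
apply: dot_eq0; have /eqP := y0 (fun i _ => s_ge0 i) i isT.
by rewrite mxE mulf_eq0 gt_eqF //= => /eqP.
Qed.

Lemma sqrtmx_spectral a : (forall i, 0 < a i) ->
  sqrtmx (spectral a) = spectral (fun i => Num.sqrt (a i)).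
Proof.
move=> a_gt0; apply: sqrtmx_unique.
  by apply: spectral_posdef => i; rewrite sqrtr_gt0.
by rewrite spectralM; apply: eq_spectral => i; rewrite -expr2 sqr_sqrtr ?ltW.
Qed.

Lemma invmx_spectral a : (forall i, 0 < a i) ->
  invmx (spectral a) = spectral (fun i => (a i)^-1).
Proof.
move=> a_gt0; apply: invmx_unique; rewrite spectralM -spectral_const.
by apply: eq_spectral => i; rewrite divff ?gt_eqF.
Qed.

Lemma invsqrtmx_spectral a : (forall i, 0 < a i) ->
  invsqrtmx (spectral a) = spectral (fun i => (Num.sqrt (a i))^-1).
Proof.
move=> a_gt0; rewrite /invsqrtmx sqrtmx_spectral // invmx_spectral // => i.
by rewrite sqrtr_gt0.
Qed.

(** On the range of each projection the mean is the scalar expression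
    [sqrt a * sqrt (b / a) * sqrt a], that is, [sqrt (a * b)]. *)
Lemma geomeanmx_spectral a b : (forall i, 0 < a i) -> (forall i, 0 < b i) ->
  geomeanmx (spectral a) (spectral b) = spectral (fun i => Num.sqrt (a i * b i)).
Proof.
move=> a_gt0 b_gt0.
rewrite /geomeanmx invsqrtmx_spectral // !spectralM.
have E i : (Num.sqrt (a i))^-1 * b i * (Num.sqrt (a i))^-1 = b i / a i.
  by rewrite mulrAC -invfM -expr2 sqr_sqrtr 1?mulrC ?ltW.
have ba_gt0 i : 0 < b i / a i by rewrite divr_gt0.
rewrite (eq_spectral E) !sqrtmx_spectral // !spectralM.
apply: eq_spectral => i.
have [ai bai] : 0 < a i /\ 0 < b i / a i by [].
rewrite -sqrtrM ?(ltW ai) // -sqrtrM ?(mulr_ge0 (ltW ai) (ltW bai)) //.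
by congr Num.sqrt; move/lt0r_neq0: ai => ai; field.
Qed.

(** For a regular graph the degree matrix is scalar, so the normalization only divides the
    eigenvalues by [d]. *)
Lemma norm_laplacian_spectral w d : 0 < d -> degmx (spectral w) = d%:M ->
  norm_laplacian (spectral w) = spectral (fun i => 1 - w i / d).
Proof.
move=> d_gt0 dE; rewrite /norm_laplacian dE -spectral_const.
rewrite invsqrtmx_spectral // spectralB !spectralM; apply: eq_spectral => i.
rewrite mulrAC -invfM -expr2 sqr_sqrtr ?ltW //.
by move/lt0r_neq0: d_gt0 => d0; field.
Qed.

Lemma norm_signless_laplacian_spectral w d :
    0 < d -> degmx (spectral w) = d%:M ->
  norm_signless_laplacian (spectral w) = spectral (fun i => 1 + w i / d).
Proof.
move=> d_gt0 dE; rewrite /norm_signless_laplacian dE -spectral_const.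
rewrite invsqrtmx_spectral // spectralD !spectralM; apply: eq_spectral => i.
rewrite mulrAC -invfM -expr2 sqr_sqrtr ?ltW //.
by move/lt0r_neq0: d_gt0 => d0; field.
Qed.

(** Projecting the eigenvalue equation of [u] by [P j] gives [(a j - mu) *: (u *m P j) = 0]. *)
Lemma spectral_eigen_proj a mu (u : 'rV[R]_n) j :
  (u <= eigenspace (spectral a) mu)%MS -> u *m P j != 0 -> a j = mu.
Proof.
move=> /eigenspaceP uE uj; apply/eqP; rewrite -subr_eq0.
have : (a j - mu) *: (u *m P j) = 0.
  by rewrite scalerBl (scalemxAl mu) -uE -mulmxA mul_spectral_proj -scalemxAr subrr.
by move/eqP; rewrite scaler_eq0 (negPf uj) orbF.
Qed.

Lemma sub_proj_eigenspace a m (U : 'M[R]_(m, n)) j :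
  U *m P j = U -> (U <= eigenspace (spectral a) (a j))%MS.
Proof.
by move=> Uj; apply/eigenspaceP; rewrite -{1}Uj -mulmxA mul_proj_spectral -scalemxAr Uj.
Qed.

End SpectralResolution.

(** Covering provides a label for each vertex; disjointness and the injectivity of [C] make it the
    only one. Membership then becomes a boolean equality. *)
Lemma equal_clusters_label (n k c : nat) (C : 'I_k -> {set 'I_n}) :
  equal_clusters c C ->
  exists lab : 'I_n -> 'I_k, forall v i, (v \in C i) = (lab v == i).
Proof.
case=> C_inj /and3P[/eqP C_cover /trivIsetP C_triv _] _.
apply: (@fin_all_exists _ (fun=> _) (fun v l => forall i, (v \in C i) = (l == i))).
move=> v; have : v \in cover [set C i | i : 'I_k] by rewrite C_cover inE.
case/bigcupP=> _ /imsetP[i _ ->] vi; exists i => j.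
have [<-//|ij] := eqVneq i j.
apply/negP=> vj; have := C_triv _ _ (imset_f C (isT : i \in 'I_k))
  (imset_f C (isT : j \in 'I_k)).
by rewrite (inj_eq C_inj) => /(_ ij)/disjointFr/(_ vi); rewrite vj.
Qed.

(** * Block matrices of clusters of equal size and their common eigenspaces *)

Section EqualClusters.

Variables (R : realType) (n k c : nat) (C : 'I_k -> {set 'I_n}).
Variable lab : 'I_n -> 'I_k.
Hypothesis labP : forall v i, (v \in C i) = (lab v == i).
Hypothesis C_card : forall i, #|C i| = c.
Hypotheses (k_gt1 : (1 < k)%N) (c_gt1 : (1 < c)%N).

(** [M] is the vertex-cluster incidence matrix; its columns are the indicator vectors of the
    clusters. *)
Let M : 'M[R]_(n, k) := \matrix_(v, i) (lab v == i)%:R.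
Let B : 'M[R]_n := \matrix_(v, w) (lab v == lab w)%:R.
Let J : 'M[R]_n := const_mx 1.

Lemma k_neq0 : k%:R != 0 :> R.
Proof. by rewrite pnatr_eq0 -lt0n ltnW. Qed.

Lemma c_neq0 : c%:R != 0 :> R.
Proof. by rewrite pnatr_eq0 -lt0n ltnW. Qed.

Lemma same_clusterE v w : same_cluster C v w = (lab v == lab w).
Proof.
apply/existsP/eqP => [[i]|vw]; first by rewrite !labP => /andP[/eqP-> /eqP->].
by exists (lab v); rewrite !labP eqxx vw eqxx.
Qed.

Lemma sum_label i : \sum_v (lab v == i)%:R = c%:R :> R.
Proof.
rewrite -(C_card i) -sum1_card natr_sum [RHS]big_mkcond /=.
by apply: eq_bigr => v _; rewrite labP; case: eqP.
Qed.

(** Double counting of the pairs of a vertex and its label. *)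
Lemma card_vertices : n%:R = k%:R * c%:R :> R.
Proof.
transitivity (\sum_(v < n) \sum_i (lab v == i)%:R : R).
  transitivity (\sum_(v < n) 1 : R); first by rewrite sumr_const card_ord.
  apply: eq_bigr => v _; rewrite (bigD1 (lab v)) //= eqxx big1 ?addr0 // => i.
  by rewrite eq_sym => /negPf->.
rewrite exchange_big /= (eq_bigr _ (fun i _ => sum_label i)).
by rewrite sumr_const card_ord mulr_natl.
Qed.

Lemma membership_gram : M^T *m M = c%:R%:M.
Proof.
apply/matrixP=> i j; rewrite !mxE.
under eq_bigr => v _ do rewrite !mxE.
have [<-|ij] := eqVneq i j.
  rewrite -[RHS](sum_label i); apply: eq_bigr => v _.
  by case: eqP; rewrite ?mul0r ?mul1r.
rewrite mulr0n big1 // => v _.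
by case: eqP => [->|_]; rewrite ?mul0r // (negPf ij) mulr0.
Qed.

Lemma membershipMT : M *m M^T = B.
Proof.
apply/matrixP=> v w; rewrite !mxE (bigD1 (lab v)) //= !mxE eqxx mul1r.
rewrite big1 ?addr0 1?eq_sym // => i iv.
by rewrite !mxE eq_sym (negPf iv) mul0r.
Qed.

Lemma blockM : B *m B = c%:R *: B.
Proof.
by rewrite -membershipMT mulmxA -(mulmxA M) membership_gram mul_mx_scalar -scalemxAl.
Qed.

Lemma onesM : J *m J = n%:R *: J.
Proof.
apply/matrixP=> v w; rewrite !mxE.
under eq_bigr => u _ do rewrite !mxE mulr1.
by rewrite sumr_const card_ord mulr1.
Qed.

Lemma block_ones : B *m J = c%:R *: J.
Proof.
apply/matrixP=> v w; rewrite !mxE -(sum_label (lab v)) mulr1.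
by apply: eq_bigr => u _; rewrite !mxE mulr1 eq_sym.
Qed.

Lemma block_sym : B^T = B.
Proof. by apply/matrixP=> v w; rewrite !mxE eq_sym. Qed.

Lemma ones_sym : J^T = J.
Proof. exact: trmx_const. Qed.

Lemma ones_block : J *m B = c%:R *: J.
Proof. by rewrite -[LHS]trmxK trmx_mul block_sym ones_sym block_ones linearZ /= ones_sym. Qed.

Lemma expected_weightE p q : expected_weight C p q = q *: J + (p - q) *: B.
Proof.
apply/matrixP=> v w; rewrite !mxE same_clusterE; case: eqP => _ /=; ring.
Qed.

(** The expected graph is regular: every vertex has [c] vertices in its own cluster, itself
    included, and [(k - 1) * c] outside. *)
Lemma degmx_expected_weight (p q : R) :
  degmx (expected_weight C p q) = (c%:R * (p + (k%:R - 1) * q))%:M.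
Proof.
rewrite /degmx -diag_const_mx; congr diag_mx; apply/rowP=> v; rewrite !mxE.
rewrite expected_weightE.
under eq_bigr => w _ do rewrite !mxE mulr1 eq_sym.
rewrite big_split /= -mulr_sumr sum_label sumr_const card_ord -[q *+ n]mulr_natl.
rewrite card_vertices; ring.
Qed.

(* Orthogonal projections on the constant vectors, on the vectors constant on
   clusters with zero sum, and on the vectors with zero sum on each cluster. *)
Definition cluster_proj (i : 'I_3) : 'M[R]_n :=
  nth 0 [:: n%:R^-1 *: J; c%:R^-1 *: B - n%:R^-1 *: J; 1%:M - c%:R^-1 *: B] i.

(** Averaging over each cluster ([E]) and over all vertices ([F]) are idempotent, and [E] fixes [F]
    on both sides; the nine products follow. *)
Lemma cluster_proj_mul i j :
  cluster_proj i *m cluster_proj j = if i == j then cluster_proj i else 0.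
Proof.
have n0 : n%:R != 0 :> R by rewrite card_vertices mulf_neq0 ?k_neq0 ?c_neq0.
have c0 := c_neq0.
set F := n%:R^-1 *: J; set E := c%:R^-1 *: B.
have FF : F *m F = F.
  by rewrite /F -scalemxAl -scalemxAr onesM (scalerA _ n%:R) mulVf // scale1r.
have EE : E *m E = E.
  by rewrite /E -scalemxAl -scalemxAr blockM (scalerA _ c%:R) mulVf // scale1r.
have EF : E *m F = F.
  rewrite /E /F -scalemxAl -scalemxAr block_ones (scalerA _ c%:R).
  by rewrite mulrC -(scalerA c%:R) (scalerA c%:R^-1) mulVf // scale1r.
have FE : F *m E = F.
  by rewrite /E /F -scalemxAl -scalemxAr ones_block (scalerA _ c%:R) mulVf // scale1r.
case: i => [[|[|[|//]]] ?]; case: j => [[|[|[|//]]] ?]; rewrite /cluster_proj /=;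
  rewrite -/E -/F -?val_eqE /= ?(mulmxBl, mulmxBr, mulmx1, mul1mx) ?(FF, EE, EF, FE);
  by rewrite ?(subrr, subr0, oppr0, opprB, addr0, addrN, addrA, subrK).
Qed.

Lemma cluster_proj_sum : \sum_i cluster_proj i = 1%:M.
Proof.
rewrite !big_ord_recl big_ord0 addr0 /cluster_proj /=.
have telescope (x y z : 'M[R]_n) : x + (y - x + (z - y)) = z.
  by rewrite addrA (addrC x) subrK addrC subrK.
exact: telescope.
Qed.

Lemma cluster_proj_sym i : (cluster_proj i)^T = cluster_proj i.
Proof.
case: i => [[|[|[|//]]] ?]; rewrite /cluster_proj /=;
  by rewrite ?(linearB, linearZ) /= ?linearZ /= ?trmx1 ?block_sym ?ones_sym.
Qed.

(** The first eigenvalue is the common degree, so dividing by the degree sends it to 1. *)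
Definition weight_eigenvalue (p q : R) (i : 'I_3) : R :=
  nth 0 [:: c%:R * (p + (k%:R - 1) * q); c%:R * (p - q); 0] i.

Lemma expected_weight_spectral p q :
  expected_weight C p q = spectral cluster_proj (weight_eigenvalue p q).
Proof.
rewrite expected_weightE /spectral !big_ord_recl big_ord0.
rewrite /cluster_proj /weight_eigenvalue /=.
have [k0 c0] := (k_neq0, c_neq0).
apply/matrixP=> v w; rewrite !mxE card_vertices; field.
by rewrite k0 c0.
Qed.

(** * The vectors [chi], their span and their position in the spectrum *)

Lemma chiE i v :
  chi R C i v = if i == 0%N :> nat then 1 else k%:R * (lab v == i)%:R - 1.
Proof. by rewrite mxE labP; case: ifP => // _; case: eqP => _; rewrite ?mulr1 ?mulr0 ?add0r. Qed.

Let i0 : 'I_k := Ordinal (ltnW k_gt1).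
Let i1 : 'I_k := Ordinal k_gt1.

(** For [i != i0] the indicator of [C i] is the sum of the rows [i] and [i0] of [chi] divided by
    [k]. The indicator of [C i0] is the constant row minus all the others. *)
Lemma membership_sub_chi : (M^T <= chi R C)%MS.
Proof.
have sub_pos (i : 'I_k) : i != i0 -> (row i M^T <= chi R C)%MS.
  move=> ii0.
  have -> : row i M^T = k%:R^-1 *: (row i (chi R C) + row i0 (chi R C)).
    apply/rowP=> v; rewrite !(mxE, chiE) /=.
    have /negPf-> : (i : nat) != 0%N by [].
    have k0 := k_neq0; field; exact: k0.
  by rewrite scalemx_sub // addmx_sub ?row_sub.
apply/row_subP=> i; have [->|] := eqVneq i i0; last exact: sub_pos.
have -> : row i0 M^T = row i0 (chi R C) - \sum_(j | j != i0) row j M^T.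
  apply/rowP=> v; rewrite !mxE /= summxE.
  apply/eqP; rewrite eq_sym subr_eq; apply/eqP.
  under eq_bigr => j _ do rewrite !mxE.
  have := bigD1 (op := +%R) i0 (P := xpredT) (F := fun i => (lab v == i)%:R : R) isT.
  move=> /= <-; rewrite (bigD1 (lab v)) //= eqxx big1 ?addr0 // => j.
  by rewrite eq_sym => /negPf->.
rewrite addmx_sub ?row_sub // eqmx_opp summx_sub // => j; exact: sub_pos.
Qed.

(** The row space contains the [k] cluster indicators, whose Gram matrix is invertible. *)
Lemma chi_row_free : row_free (chi R C).
Proof.
rewrite -row_leq_rank; apply: leq_trans (mxrankS membership_sub_chi).
have rk : \rank (M^T *m M) = k.
  apply/eqP; rewrite mxrank_unit // membership_gram unitmxE det_scalar unitfE.
  by rewrite expf_neq0 ?c_neq0.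
by rewrite -{1}rk; apply: mxrankM_maxl.
Qed.

Lemma chi_in_membership i :
  exists h : 'rV[R]_k, row i (chi R C) = h *m M^T.
Proof.
exists (\row_j if i == 0%N :> nat then 1 else k%:R * (i == j)%:R - 1).
apply/rowP=> v; rewrite mxE chiE mxE (bigD1 (lab v)) //= big1 ?addr0.
  by rewrite !mxE eqxx mulr1 (eq_sym i).
by move=> j; rewrite !mxE eq_sym => /negPf->; rewrite mulr0.
Qed.

Lemma chi_block i : row i (chi R C) *m B = c%:R *: row i (chi R C).
Proof.
have [h ->] := chi_in_membership i.
by rewrite -membershipMT mulmxA -(mulmxA h) membership_gram mul_mx_scalar -scalemxAl.
Qed.

Lemma chi_ones i : i != i0 -> row i (chi R C) *m J = 0.
Proof.
move=> ii0; apply/rowP=> w; rewrite !mxE.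
under eq_bigr => v _ do rewrite mxE [J _ _]mxE mulr1 chiE.
have /negPf-> : (i : nat) != 0%N by [].
rewrite sumrB -mulr_sumr sum_label sumr_const card_ord card_vertices.
by rewrite subrr.
Qed.

Lemma chi_proj2 i : row i (chi R C) *m cluster_proj (inord 2) = 0.
Proof.
rewrite /cluster_proj inordK //= mulmxBr mulmx1 -scalemxAr chi_block scalerA.
by rewrite mulVf ?c_neq0 // scale1r subrr.
Qed.

Lemma chi_proj1 i :
  i != i0 -> row i (chi R C) *m cluster_proj (inord 1) = row i (chi R C).
Proof.
move=> ii0; rewrite /cluster_proj inordK //= mulmxBr -!scalemxAr chi_block.
by rewrite chi_ones // scaler0 subr0 scalerA mulVf ?c_neq0 // scale1r.
Qed.

Lemma chi_proj0 : row i0 (chi R C) *m cluster_proj (inord 0) = row i0 (chi R C).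
Proof.
rewrite /cluster_proj inordK //= -scalemxAr; apply/rowP=> w; rewrite !mxE.
under eq_bigr => v _ do rewrite mxE [J _ _]mxE mulr1 chiE /=.
rewrite sumr_const card_ord mulVf //.
by rewrite card_vertices mulf_neq0 ?k_neq0 ?c_neq0.
Qed.

(** A vector killed by the third projection equals its own cluster averages, hence is a combination
    of cluster indicators. *)
Lemma sub_chi (u : 'rV[R]_n) :
  (u <= chi R C)%MS = (u *m cluster_proj (inord 2) == 0).
Proof.
apply/idP/eqP => [/submxP[h ->]|].
  rewrite -mulmxA; have -> : chi R C *m cluster_proj (inord 2) = 0.
    by apply/row_matrixP=> i; rewrite row_mul chi_proj2 row0.
  by rewrite mulmx0.
rewrite /cluster_proj inordK //= mulmxBr mulmx1 => /eqP.
rewrite subr_eq0 => /eqP->; rewrite -scalemxAr scalemx_sub //.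
rewrite -membershipMT mulmxA; apply: submx_trans membership_sub_chi.
exact: submxMl.
Qed.

(** Rows [i0] and [i1] realize the first two eigenvalues. A vector outside the span of [chi] has a
    nonzero third component, so as an eigenvector it can only have the third eigenvalue. *)
Lemma smallest_eigenvectors_chi (f : 'I_3 -> R) :
  smallest_eigenvectors (spectral cluster_proj f) (chi R C) <->
  f (inord 0) < f (inord 2) /\ f (inord 1) < f (inord 2).
Proof.
have P_mul := cluster_proj_mul.
split=> [[_ [lambda [chi_eig lt_eig]]]|[lt02 lt12]].
  have row_neq0 i : row i (chi R C) != 0.
    apply/negP=> /eqP ri0; have := row_free_inj chi_row_free.
    move=> /(_ 1%N (delta_mx 0 i) 0) /=; rewrite -rowE ri0 mul0mx => /(_ erefl).
    by move/matrixP/(_ 0 i)/eqP; rewrite !mxE !eqxx oner_eq0.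
  have lam0 : f (inord 0) = lambda i0.
    apply: (spectral_eigen_proj P_mul (chi_eig i0)).
    by rewrite chi_proj0 row_neq0.
  have lam1 : f (inord 1) = lambda i1.
    apply: (spectral_eigen_proj P_mul (chi_eig i1)).
    by rewrite chi_proj1 ?row_neq0.
  (* Since [c > 1], the third eigenspace is nonzero: the difference [u] of the basis vectors at two
     vertices of one cluster has zero sum on each cluster. *)
  have [v [w [vw lvw]]] : exists v w, v != w /\ lab v = lab w.
    have : (1 < #|C i0|)%N by rewrite C_card.
    case/card_gt1P=> v [w [+ + vw]]; rewrite !labP => /eqP lv /eqP lw.
    by exists v, w; rewrite lv lw.
  pose u : 'rV[R]_n := delta_mx 0 v - delta_mx 0 w.
  have uP : u *m cluster_proj (inord 2) = u.
    have uB : u *m B = 0.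
      rewrite /u mulmxBl -!rowE; apply/rowP=> x.
      by rewrite !mxE lvw subrr.
    by rewrite /cluster_proj inordK //= mulmxBr mulmx1 -scalemxAr uB scaler0 subr0.
  have u_notin : ~~ (u <= chi R C)%MS.
    rewrite sub_chi uP; apply/eqP=> /rowP/(_ v)/eqP.
    by rewrite !mxE !eqxx (negPf vw) subr0 oner_eq0.
  have u_eig := sub_proj_eigenspace P_mul f uP.
  by rewrite lam0 lam1 !(lt_eig _ _ u_eig u_notin).
split; first exact: chi_row_free.
exists (fun i => if i == i0 then f (inord 0) else f (inord 1)); split=> [i|mu u u_eig].
  case: ifP => [/eqP->|/negbT ii0]; apply: sub_proj_eigenspace => //.
    exact: chi_proj0.
  exact: chi_proj1.
by rewrite sub_chi => /(spectral_eigen_proj P_mul u_eig) <- i; case: ifP.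
Qed.

(** * Spectra of the expected Laplacians and of their geometric mean *)

Section ExpectedGraph.

Variables p_in_pos p_out_pos p_in_neg p_out_neg : R.
Hypotheses (p_in_neg_ge0 : 0 <= p_in_neg) (p_out_pos_ge0 : 0 <= p_out_pos).
Hypothesis p_out_neg_ge0 : 0 <= p_out_neg.
Hypothesis deg_pos_gt0 : 0 < p_in_pos + (k%:R - 1) * p_out_pos.
Hypothesis deg_neg_gt0 : 0 < p_in_neg + (k%:R - 1) * p_out_neg.

Let a := k%:R * p_out_pos / (p_in_pos + (k%:R - 1) * p_out_pos).
Let b := 1 + (p_in_neg - p_out_neg) / (p_in_neg + (k%:R - 1) * p_out_neg).

Lemma laplacian_informative_ge0 : 0 <= a.
Proof. by rewrite divr_ge0 ?mulr_ge0 // ltW. Qed.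

(** Over the common denominator, [p_out_neg] gets the coefficient [k - 2], which is nonnegative as
    [k] is at least 2. *)
Lemma signless_informative_ge0 : 0 <= b.
Proof.
have k_ge2 : 2 <= k%:R :> R by rewrite ler_nat.
have bE : b * (p_in_neg + (k%:R - 1) * p_out_neg) =
    2 * p_in_neg + (k%:R - 2) * p_out_neg.
  by rewrite /b; have d0 := lt0r_neq0 deg_neg_gt0; field.
rewrite -(pmulr_lge0 _ deg_neg_gt0) bE.
by rewrite addr_ge0 ?mulr_ge0 ?subr_ge0.
Qed.

Lemma norm_laplacian_expected : norm_laplacian (expected_weight C p_in_pos p_out_pos) =
  spectral cluster_proj (fun i => nth 0 [:: 0; a; 1] i).
Proof.
have c_gt0 : 0 < c%:R :> R by rewrite ltr0n ltnW.
have := degmx_expected_weight p_in_pos p_out_pos.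
rewrite expected_weight_spectral => /(norm_laplacian_spectral cluster_proj_mul
  cluster_proj_sum cluster_proj_sym (mulr_gt0 c_gt0 deg_pos_gt0)) ->.
have [c0 d0] := (lt0r_neq0 c_gt0, lt0r_neq0 deg_pos_gt0).
apply: eq_spectral => -[[|[|[|//]]] ?]; rewrite /weight_eigenvalue /=.
- by rewrite divff ?subrr ?mulf_neq0.
- by rewrite /a; field; rewrite c0 d0.
- by rewrite mul0r subr0.
Qed.

Lemma norm_signless_laplacian_expected :
  norm_signless_laplacian (expected_weight C p_in_neg p_out_neg) =
  spectral cluster_proj (fun i => nth 0 [:: 2; b; 1] i).
Proof.
have c_gt0 : 0 < c%:R :> R by rewrite ltr0n ltnW.
have := degmx_expected_weight p_in_neg p_out_neg.
rewrite expected_weight_spectral => /(norm_signless_laplacian_spectral cluster_proj_mul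
  cluster_proj_sum cluster_proj_sym (mulr_gt0 c_gt0 deg_neg_gt0)) ->.
have [c0 d0] := (lt0r_neq0 c_gt0, lt0r_neq0 deg_neg_gt0).
apply: eq_spectral => -[[|[|[|//]]] ?]; rewrite /weight_eigenvalue /=.
- by rewrite divff ?mulf_neq0.
- by rewrite /b; field; rewrite c0 d0.
- by rewrite mul0r addr0.
Qed.

(** The shifts make every eigenvalue of both arguments positive, and as the square root is
    increasing, comparing eigenvalues of the mean amounts to comparing radicands. *)
Lemma smallest_eigenvectors_LGM e1 e2 : 0 < e1 -> 0 < e2 ->
  smallest_eigenvectors
    (expected_LGM C p_in_pos p_out_pos p_in_neg p_out_neg e1 e2) (chi R C) <->
  e1 * (2 + e2) < (1 + e1) * (1 + e2) /\
  (a + e1) * (b + e2) < (1 + e1) * (1 + e2).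
Proof.
move=> e1_gt0 e2_gt0.
have [a_ge0 b_ge0] := (laplacian_informative_ge0, signless_informative_ge0).
rewrite /expected_LGM norm_laplacian_expected norm_signless_laplacian_expected.
rewrite -!(spectral_const cluster_proj_sum) !spectralD.
rewrite (geomeanmx_spectral cluster_proj_mul cluster_proj_sum cluster_proj_sym).
- rewrite smallest_eigenvectors_chi !inordK //= add0r.
  by rewrite !ltr_sqrt ?mulr_gt0 ?addr_gt0.
- by move=> [[|[|[|//]]] ?] /=; lra.
- by move=> [[|[|[|//]]] ?] /=; lra.
Qed.

End ExpectedGraph.

End EqualClusters.

(* If [a * b >= 1] then [a + b >= 2] by AM-GM, and equal shifts already violate
   the inequality. *)
Lemma shifted_product_lt (R : realType) (a b : R) : 0 <= a -> 0 <= b ->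
  (exists delta : R, 0 < delta /\
     forall e1 e2 : R, 0 < e1 < delta -> 0 < e2 < delta ->
       e1 * (2 + e2) < (1 + e1) * (1 + e2) /\
       (a + e1) * (b + e2) < (1 + e1) * (1 + e2)) <->
  a * b < 1.
Proof.
move=> a_ge0 b_ge0; split=> [[delta [delta_gt0 small]]|ab_lt1].
  rewrite ltNge; apply/negP=> ab_ge1.
  have half : 0 < delta / 2 < delta by apply/andP; split; lra.
  have [_] := small _ _ half half.
  set e := delta / 2; have e_gt0 : 0 < e by case/andP: half.
  have ab_ge2 : 2 <= a + b.
    rewrite -(@ler_pXn2r _ 2) ?nnegrE ?addr_ge0 // -subr_ge0.
    have -> : (a + b) ^+ 2 - 2 ^+ 2 = (a - b) ^+ 2 + 4 * (a * b - 1) by ring.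
    by rewrite addr_ge0 ?sqr_ge0 // mulr_ge0 ?subr_ge0.
  have : 0 <= (a + b - 2) * e by rewrite mulr_ge0 ?subr_ge0 // ltW.
  nra.
(* The bound [d = (1 - a * b) / s] satisfies [(a + b) * d = 1 - a * b - d], so the perturbation
   [a * e2 + b * e1] stays below [1 - a * b]. Moreover [d <= 1], and the first inequality says just
   [e1 < 1 + e2]. *)
pose s := 1 + a + b; have s_gt0 : 0 < s by rewrite /s; lra.
have s_ge1 : 1 <= s by rewrite /s; lra.
exists ((1 - a * b) / s); have d_gt0 : 0 < (1 - a * b) / s.
  by rewrite divr_gt0 // subr_gt0.
split=> // e1 e2 /andP[e1_gt0 e1_lt] /andP[e2_gt0 e2_lt].
have d_le1 : (1 - a * b) / s <= 1.
  by rewrite ler_pdivrMr // mul1r; have := mulr_ge0 a_ge0 b_ge0; lra.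
move: e1_lt e2_lt; set d := _ / s => e1_lt e2_lt.
have dE : d * s = 1 - a * b by rewrite /d divfK ?gt_eqF.
split; first by nra.
have : a * e2 <= a * d by rewrite ler_wpM2l // ltW.
have : b * e1 <= b * d by rewrite ler_wpM2l // ltW.
by move: dE; rewrite /s; nra.
Qed.

Unset Implicit Arguments.
Set Strict Implicit.

Theorem theorem3 (R : realType) (n k c : nat) (C : 'I_k -> {set 'I_n})
    (p_in_pos p_out_pos p_in_neg p_out_neg : R)
    (hk : (2 <= k)%N) (hc : (2 <= c)%N) (hC : equal_clusters c C)
    (hp_in_pos : 0 <= p_in_pos <= 1) (hp_out_pos : 0 <= p_out_pos <= 1)
    (hp_in_neg : 0 <= p_in_neg <= 1) (hp_out_neg : 0 <= p_out_neg <= 1)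
    (hdeg_pos : 0 < p_in_pos + (k%:R - 1) * p_out_pos)
    (hdeg_neg : 0 < p_in_neg + (k%:R - 1) * p_out_neg) :
  (exists delta : R, 0 < delta /\
     forall eps1 eps2 : R, 0 < eps1 < delta -> 0 < eps2 < delta ->
       smallest_eigenvectors
         (expected_LGM C p_in_pos p_out_pos p_in_neg p_out_neg eps1 eps2)
         (chi R C))
  <->
  (k%:R * p_out_pos / (p_in_pos + (k%:R - 1) * p_out_pos)) *
  (1 + (p_in_neg - p_out_neg) / (p_in_neg + (k%:R - 1) * p_out_neg)) < 1.
Proof.
have [lab labP] := equal_clusters_label hC.
have C_card : forall i, #|C i| = c by case: hC.
case/andP: hp_out_pos => p_out_pos_ge0 _; case/andP: hp_in_neg => p_in_neg_ge0 _.
case/andP: hp_out_neg => p_out_neg_ge0 _.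
have LGM := smallest_eigenvectors_LGM labP C_card hk hc p_in_neg_ge0
  p_out_pos_ge0 p_out_neg_ge0 hdeg_pos hdeg_neg.
have shifted := shifted_product_lt
  (laplacian_informative_ge0 p_out_pos_ge0 hdeg_pos)
  (signless_informative_ge0 hk p_in_neg_ge0 p_out_neg_ge0 hdeg_neg).
apply: iff_trans shifted.
(* The equivalence [LGM] holds for each pair of positive shifts, so the same [delta] serves in both
   directions. *)
split=> -[delta [delta_gt0 small]]; exists delta; split=> // e1 e2 e1P e2P;
  have [e1_gt0 _] := andP e1P; have [e2_gt0 _] := andP e2P.
- exact/(LGM _ _ e1_gt0 e2_gt0)/small.
- exact/(LGM _ _ e1_gt0 e2_gt0)/small.
Qed.
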